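(* Let $k$ be an algebraically closed field of characteristic $0$ and let $G=(I,(\Gamma_i)_{i\in I},(M_{ij})_{(i,j)\in I^2})$ be a group species. Then the $k$-pseudo-modulation $((k\Gamma_i)_{i\in Q_0},(M_{ij})_{(i,j)\in Q_1})$, where $Q_0=I$ and $Q_1=\{(i,j)\in I^2: M_{ij}\neq0\}$, is a semi-normal generalized modulation.
   Context: A group species is a triple $(I,(\Gamma_i)_{i\in I},(M_{ij})_{(i,j)\in I^2})$ where $I$ is a finite set, each $\Gamma_i$ is a finite group and each $M_{ij}$ is a finite-dimensional ($k$-central) $(k\Gamma_i,k\Gamma_j)$-bimodule. It is regarded as a pseudo-modulation with algebras $k\Gamma_i$ and bimodules $M_{ij}$ over the pseudo-valued quiver with vertex set $I$, an arrow from $i$ to $j$ whenever $M_{ij}\ne0$, valued by the ranks (minimal numbers of generators) of $M_{ij}$ as a left $k\Gamma_i$-module and as a right $k\Gamma_j$-module. In general a $k$-pseudo-modulation $(A_i,{}_iM_j)$ consists of artinian $k$-algebras $A_i$ and finitely generated unital $A_i$-$A_j$-bimodules ${}_iM_j$ whose one-sided ranks are the valuations of the underlying pseudo-valued graph or quiver. It is semi-normal if all $A_i$ are semisimple, and it is a generalized modulation if $\mathrm{Hom}_{A_i}({}_iM_j,A_i)\cong\mathrm{Hom}_{A_j}({}_iM_j,A_j)$ as $A_j$-$A_i$-bimodules for all pairs $(i,j)$ (left $A_i$-homomorphisms and right $A_j$-homomorphisms, respectively). *)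

(* Defs.v *)
From HB Require Import structures.
From mathcomp Require Import all_boot all_order all_fingroup all_algebra.
From mathcomp Require Import all_classical.

Set Implicit Arguments.
Unset Strict Implicit.
Unset Printing Implicit Defensive.

Import GRing.Theory.
Local Open Scope ring_scope.

(** * Modules *)

Section Modules.
Variables (R : pzRingType) (M : lmodType R).

Definition generated_by (n : nat) : Prop :=
  exists v : 'I_n -> M, forall x : M, exists c : 'I_n -> R,
    x = \sum_i c i *: v i.

Definition is_rank (n : nat) : Prop :=
  generated_by n /\ forall m, generated_by m -> (n <= m)%N.

(* The junk value 0 is taken only when [M] is not finitely generated. *)
Definition rank : nat := xget 0%N [set n | is_rank n]%classic.

Definition artinian_module : Prop :=
  forall S : nat -> {pred M},
    (forall n, GRing.submod_closed (S n)) ->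
    (forall n, {subset S n.+1 <= S n}) ->
  exists N, forall n, (N <= n)%N -> S n =i S N.

Definition simple_submodule (S : {pred M}) : Prop :=
  [/\ GRing.submod_closed S,
      exists2 x, x \in S & x != 0
    & forall T : {pred M}, GRing.submod_closed T -> {subset T <= S} ->
        T =i pred1 0 \/ T =i S].

End Modules.

(* Right modules over [R] are left modules over the converse ring [R^c]. *)
Definition artinian_ring (R : nzRingType) : Prop :=
  artinian_module R^o /\ artinian_module (R^c)^o.

(* The left regular module is a (finite) direct sum of simple left ideals. *)
Definition semisimple_ring (R : nzRingType) : Prop :=
  exists n (L : 'I_n -> {pred R^o}),
    (forall i, simple_submodule (L i)) /\
    (forall x : R^o, exists! c : {ffun 'I_n -> R^o},
       (forall i, c i \in L i) /\ x = \sum_i c i).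

(** * Bimodules *)

HB.mixin Record isBimodule (R S : nzRingType) M of GRing.Zmodule M := {
  actl : R -> M -> M;
  actr : M -> S -> M;
  actlA : forall r r' m, actl r (actl r' m) = actl (r * r') m;
  actl1 : forall m, actl 1 m = m;
  actlDr : forall r m m', actl r (m + m') = actl r m + actl r m';
  actlDl : forall r r' m, actl (r + r') m = actl r m + actl r' m;
  actrA : forall m s s', actr (actr m s) s' = actr m (s * s');
  actr1 : forall m, actr m 1 = m;
  actrDl : forall m m' s, actr (m + m') s = actr m s + actr m' s;
  actrDr : forall m s s', actr m (s + s') = actr m s + actr m s';
  lactrA : forall r m s, actr (actl r m) s = actl r (actr m s)
}.

#[short(type="bimodType")]
HB.structure Definition Bimodule (R S : nzRingType) :=
  {M of GRing.Zmodule M & isBimodule R S M}.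

Definition bimod_iso (R S : nzRingType) (M N : bimodType R S) : Prop :=
  exists phi : {additive M -> N},
    [/\ bijective phi,
        forall (r : R) (m : M), phi (actl r m) = actl r (phi m)
      & forall (m : M) (s : S), phi (actr m s) = actr (phi m) s].

Definition left_module (R S : nzRingType) (M : bimodType R S) : Type := M.
Definition right_module (R S : nzRingType) (M : bimodType R S) : Type := M.

Section OneSided.
Variables (R S : nzRingType) (M : bimodType R S).

HB.instance Definition _ := GRing.Zmodule.on (left_module M).
HB.instance Definition _ := GRing.Zmodule_isLmodule.Build R (left_module M)
  (@actlA R S M) (@actl1 R S M) (@actlDr R S M)
  (fun m r r' => @actlDl R S M r r' m).

Definition conv_actr (s : S^c) (m : M) : M := actr m s.

Fact conv_actrA s s' m : conv_actr s (conv_actr s' m) = conv_actr (s * s') m.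
Proof. exact: actrA. Qed.

Fact conv_actrDr : right_distributive conv_actr +%R.
Proof. by move=> s m m'; exact: actrDl. Qed.

HB.instance Definition _ := GRing.Zmodule.on (right_module M).
HB.instance Definition _ := GRing.Zmodule_isLmodule.Build S^c (right_module M)
  conv_actrA (@actr1 R S M) conv_actrDr (@actrDr R S M).

End OneSided.

(** * Homomorphism groups and one-sided duals of bimodules *)

Definition lin_hom (R : pzRingType) (U V : lmodType R) := {linear U -> V}.

Section LinHom.
Variables (R : pzRingType) (U V : lmodType R).
Implicit Types f g h : lin_hom U V.

HB.instance Definition _ := gen_eqMixin (lin_hom U V).
HB.instance Definition _ := gen_choiceMixin (lin_hom U V).

Lemma lin_hom_ext f g :
  (forall u, (f : {linear U -> V}) u = (g : {linear U -> V}) u) -> f = g.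
Proof.
case: f g => [f cf] [g cg] /= /funext efg; case: _ / efg in cg *.
congr GRing.Linear.Pack.
case: cf cg => [[[f0 fD]] [fZ]] [[[g0 gD]] [gZ]].
by rewrite (Prop_irrelevance f0 g0) (Prop_irrelevance fD gD) (Prop_irrelevance fZ gZ).
Qed.

Definition lin_hom_zero : lin_hom U V := (\0 : {linear U -> V}).
Definition lin_hom_opp f : lin_hom U V :=
  (\- (f : {linear U -> V}) : {linear U -> V}).
Definition lin_hom_add f g : lin_hom U V :=
  ((f : {linear U -> V}) \+ (g : {linear U -> V}) : {linear U -> V}).

Fact lin_hom_addA : associative lin_hom_add.
Proof. by move=> f g h; apply: lin_hom_ext => u /=; rewrite addrA. Qed.

Fact lin_hom_addC : commutative lin_hom_add.
Proof. by move=> f g; apply: lin_hom_ext => u /=; rewrite addrC. Qed.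

Fact lin_hom_add0 : left_id lin_hom_zero lin_hom_add.
Proof. by move=> f; apply: lin_hom_ext => u /=; rewrite add0r. Qed.

Fact lin_hom_addN : left_inverse lin_hom_zero lin_hom_opp lin_hom_add.
Proof. by move=> f; apply: lin_hom_ext => u /=; rewrite addNr. Qed.

HB.instance Definition _ := GRing.isZmodule.Build (lin_hom U V)
  lin_hom_addA lin_hom_addC lin_hom_add0 lin_hom_addN.

End LinHom.

(* For an [R]-[S]-bimodule [M], both duals are [S]-[R]-bimodules:
   (s f)(m) = f(ms) and (f r)(m) = f(m)r on Hom_R(M, R), while
   (s g)(m) = s g(m) and (g r)(m) = g(rm) on Hom_S(M, S). *)
Definition left_dual (R S : nzRingType) (M : bimodType R S) :=
  lin_hom (left_module M) R^o.
Definition right_dual (R S : nzRingType) (M : bimodType R S) :=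
  lin_hom (right_module M) (S^c)^o.

Section LeftDual.
Variables (R S : nzRingType) (M : bimodType R S).
Implicit Types f g : left_dual M.

HB.instance Definition _ := GRing.Zmodule.on (left_dual M).

Definition ldual_eval f (m : M) : R := (f : {linear left_module M -> R^o}) m.

Section Actions.
Variable f : left_dual M.

Definition ldual_actl_fun (s : S) (m : left_module M) : R^o :=
  ldual_eval f (actr (m : M) s).
Definition ldual_actr_fun (r : R) (m : left_module M) : R^o :=
  ldual_eval f m * r.

Fact ldual_actl_linear s : linear (ldual_actl_fun s).
Proof.
move=> r m m'; rewrite /ldual_actl_fun /ldual_eval.
rewrite (_ : actr _ s = r *: (actr (m : M) s : left_module M)
                        + (actr (m' : M) s : left_module M)) ?linearP //.
by rewrite [LHS]actrDl; congr (_ + _); exact: lactrA.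
Qed.

Fact ldual_actr_linear r : linear (ldual_actr_fun r).
Proof.
move=> a m m'; rewrite /ldual_actr_fun /ldual_eval linearP mulrDl.
by congr (_ + _); exact: esym (mulrA _ _ _).
Qed.

HB.instance Definition _ s :=
  GRing.isLinear.Build R (left_module M) R^o *:%R (ldual_actl_fun s)
    (ldual_actl_linear s).
HB.instance Definition _ r :=
  GRing.isLinear.Build R (left_module M) R^o *:%R (ldual_actr_fun r)
    (ldual_actr_linear r).

End Actions.

Definition ldual_actl (s : S) f : left_dual M :=
  (ldual_actl_fun f s : {linear left_module M -> R^o}).
Definition ldual_actr f (r : R) : left_dual M :=
  (ldual_actr_fun f r : {linear left_module M -> R^o}).

Fact ldual_actlA s t f : ldual_actl s (ldual_actl t f) = ldual_actl (s * t) f.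
Proof.
by apply: lin_hom_ext => m; congr (ldual_eval f _); exact: actrA.
Qed.
Fact ldual_actl1 f : ldual_actl 1 f = f.
Proof.
by apply: lin_hom_ext => m; congr (ldual_eval f _); exact: actr1.
Qed.
Fact ldual_actlDr s f g :
  ldual_actl s (f + g) = ldual_actl s f + ldual_actl s g.
Proof. by apply: lin_hom_ext. Qed.
Fact ldual_actlDl s t f :
  ldual_actl (s + t) f = ldual_actl s f + ldual_actl t f.
Proof.
apply: lin_hom_ext => m /=; rewrite /ldual_actl_fun /ldual_eval actrDr.
exact: (raddfD (f : {linear left_module M -> R^o})).
Qed.
Fact ldual_actrA f r t : ldual_actr (ldual_actr f r) t = ldual_actr f (r * t).
Proof. by apply: lin_hom_ext => m; exact: esym (mulrA _ _ _). Qed.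
Fact ldual_actr1 f : ldual_actr f 1 = f.
Proof. by apply: lin_hom_ext => m; exact: mulr1. Qed.
Fact ldual_actrDl f g r :
  ldual_actr (f + g) r = ldual_actr f r + ldual_actr g r.
Proof. by apply: lin_hom_ext => m; exact: mulrDl. Qed.
Fact ldual_actrDr f r t :
  ldual_actr f (r + t) = ldual_actr f r + ldual_actr f t.
Proof. by apply: lin_hom_ext => m; exact: mulrDr. Qed.
Fact ldual_lactrA s f r :
  ldual_actr (ldual_actl s f) r = ldual_actl s (ldual_actr f r).
Proof. by apply: lin_hom_ext. Qed.

HB.instance Definition _ := isBimodule.Build S R (left_dual M)
  ldual_actlA ldual_actl1 ldual_actlDr ldual_actlDl
  ldual_actrA ldual_actr1 ldual_actrDl ldual_actrDr ldual_lactrA.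

End LeftDual.

Section RightDual.
Variables (R S : nzRingType) (M : bimodType R S).
Implicit Types f g : right_dual M.

HB.instance Definition _ := GRing.Zmodule.on (right_dual M).

Definition rdual_eval g (m : M) : S :=
  (g : {linear right_module M -> (S^c)^o}) m.

Section Actions.
Variable g : right_dual M.

Definition rdual_actl_fun (s : S) (m : right_module M) : (S^c)^o :=
  s * rdual_eval g m.
Definition rdual_actr_fun (r : R) (m : right_module M) : (S^c)^o :=
  rdual_eval g (actl r (m : M)).

Fact rdual_actl_linear s : linear (rdual_actl_fun s).
Proof.
move=> a m m'; rewrite /rdual_actl_fun /rdual_eval linearP.
by rewrite [LHS](mulrDr s); congr (_ + _); exact: (@mulrA S).
Qed.

Fact rdual_actr_linear r : linear (rdual_actr_fun r).
Proof.
move=> s m m'; rewrite /rdual_actr_fun /rdual_eval.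
rewrite (_ : actl r _ = s *: (actl r (m : M) : right_module M)
                        + (actl r (m' : M) : right_module M)) ?linearP //.
by rewrite [LHS]actlDr; congr (_ + _); exact: esym (lactrA _ _ _).
Qed.

HB.instance Definition _ s :=
  GRing.isLinear.Build S^c (right_module M) (S^c)^o *:%R (rdual_actl_fun s)
    (rdual_actl_linear s).
HB.instance Definition _ r :=
  GRing.isLinear.Build S^c (right_module M) (S^c)^o *:%R (rdual_actr_fun r)
    (rdual_actr_linear r).

End Actions.

Definition rdual_actl (s : S) g : right_dual M :=
  (rdual_actl_fun g s : {linear right_module M -> (S^c)^o}).
Definition rdual_actr g (r : R) : right_dual M :=
  (rdual_actr_fun g r : {linear right_module M -> (S^c)^o}).

Fact rdual_actlA s t g : rdual_actl s (rdual_actl t g) = rdual_actl (s * t) g.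
Proof. by apply: lin_hom_ext => m; exact: (@mulrA S). Qed.
Fact rdual_actl1 g : rdual_actl 1 g = g.
Proof. by apply: lin_hom_ext => m; exact: (@mul1r S). Qed.
Fact rdual_actlDr s f g :
  rdual_actl s (f + g) = rdual_actl s f + rdual_actl s g.
Proof. by apply: lin_hom_ext => m; exact: (@mulrDr S). Qed.
Fact rdual_actlDl s t g :
  rdual_actl (s + t) g = rdual_actl s g + rdual_actl t g.
Proof. by apply: lin_hom_ext => m; exact: (@mulrDl S). Qed.
Fact rdual_actrA g r t : rdual_actr (rdual_actr g r) t = rdual_actr g (r * t).
Proof.
by apply: lin_hom_ext => m; congr (rdual_eval g _); exact: actlA.
Qed.
Fact rdual_actr1 g : rdual_actr g 1 = g.
Proof.
by apply: lin_hom_ext => m; congr (rdual_eval g _); exact: actl1.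
Qed.
Fact rdual_actrDl f g r :
  rdual_actr (f + g) r = rdual_actr f r + rdual_actr g r.
Proof. by apply: lin_hom_ext. Qed.
Fact rdual_actrDr g r t :
  rdual_actr g (r + t) = rdual_actr g r + rdual_actr g t.
Proof.
apply: lin_hom_ext => m /=; rewrite /rdual_actr_fun /rdual_eval actlDl.
exact: (raddfD (g : {linear right_module M -> (S^c)^o})).
Qed.
Fact rdual_lactrA s g r :
  rdual_actr (rdual_actl s g) r = rdual_actl s (rdual_actr g r).
Proof. by apply: lin_hom_ext. Qed.

HB.instance Definition _ := isBimodule.Build S R (right_dual M)
  rdual_actlA rdual_actl1 rdual_actlDr rdual_actlDl
  rdual_actrA rdual_actr1 rdual_actrDl rdual_actrDr rdual_lactrA.

End RightDual.

(** * Group algebras *)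

Definition group_algebra (k : fieldType) (gT : finGroupType) : Type :=
  {ffun gT -> k^o}.

Section GroupAlgebra.
Variables (k : fieldType) (gT : finGroupType).
Local Notation kG := (group_algebra k gT).
Implicit Types a b c : kG.

HB.instance Definition _ := Vector.on kG.

Definition galg_one : kG := [ffun x => (x == 1%g)%:R].
Definition galg_mul a b : kG :=
  [ffun x => \sum_(y : gT) a y * b (y^-1 * x)%g].

Fact galg_mulA : associative galg_mul.
Proof.
move=> a b c; apply/ffunP => x; rewrite !ffunE.
under eq_bigr do rewrite ffunE mulr_sumr.
under [RHS]eq_bigr do rewrite ffunE mulr_suml.
rewrite [RHS]exchange_big; apply: eq_bigr => y _.
rewrite [RHS](reindex_inj (mulgI y)); apply: eq_bigr => z _.
by rewrite mulKg invMg mulgA mulrA.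
Qed.

Fact galg_mul1l : left_id galg_one galg_mul.
Proof.
move=> a; apply/ffunP => x; rewrite ffunE (bigD1 1%g) //= ffunE eqxx.
rewrite invg1 mul1g mul1r big1 ?addr0 // => y /negPf y1.
by rewrite ffunE y1 mul0r.
Qed.

Fact galg_mul1r : right_id galg_one galg_mul.
Proof.
move=> a; apply/ffunP => x; rewrite ffunE (bigD1 x) //= ffunE mulVg eqxx.
rewrite mulr1 big1 ?addr0 // => y yx.
by rewrite ffunE -eq_mulVg1 (negPf yx) mulr0.
Qed.

Fact galg_mulDl : left_distributive galg_mul +%R.
Proof.
move=> a b c; apply/ffunP => x; rewrite !ffunE -big_split.
by apply: eq_bigr => y _; rewrite ffunE mulrDl.
Qed.

Fact galg_mulDr : right_distributive galg_mul +%R.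
Proof.
move=> a b c; apply/ffunP => x; rewrite !ffunE -big_split.
by apply: eq_bigr => y _; rewrite ffunE mulrDr.
Qed.

Fact galg_one_neq0 : galg_one != 0.
Proof. by apply/eqP => /ffunP /(_ 1%g) /eqP; rewrite !ffunE eqxx oner_eq0. Qed.

HB.instance Definition _ := GRing.Zmodule_isNzRing.Build kG
  galg_mulA galg_mul1l galg_mul1r galg_mulDl galg_mulDr galg_one_neq0.

Fact galg_scaleAl (l : k) a b : l *: (a * b) = (l *: a) * b.
Proof.
apply/ffunP => x; rewrite !ffunE scaler_sumr; apply: eq_bigr => y _.
by rewrite ffunE; exact: mulrA.
Qed.

HB.instance Definition _ := GRing.Lmodule_isLalgebra.Build k kG galg_scaleAl.

Fact galg_scaleAr (l : k) a b : l *: (a * b) = a * (l *: b).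
Proof.
apply/ffunP => x; rewrite !ffunE scaler_sumr; apply: eq_bigr => y _.
by rewrite ffunE; exact: mulrCA.
Qed.

HB.instance Definition _ := GRing.Lalgebra_isAlgebra.Build k kG galg_scaleAr.

End GroupAlgebra.

(** * Pseudo-modulations *)

(* At most one arrow from a vertex to another; loops and pairs of opposite
   arrows are allowed. *)
Record valued_quiver := ValuedQuiver {
  vertex : finType;
  arrows : {set vertex * vertex};
  valuation : {a : vertex * vertex | a \in arrows} -> nat * nat
}.

Definition arrow (Q : valued_quiver) : Type :=
  {a : vertex Q * vertex Q | a \in arrows Q}.
Definition source (Q : valued_quiver) (a : arrow Q) : vertex Q := (val a).1.
Definition target (Q : valued_quiver) (a : arrow Q) : vertex Q := (val a).2.

Definition pseudo_valued (Q : valued_quiver) : Prop :=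
  forall a : arrow Q, (0 < (valuation a).1)%N /\ (0 < (valuation a).2)%N.

Record modulation_data (k : fieldType) := ModulationData {
  quiver : valued_quiver;
  alg : vertex quiver -> algType k;
  bim : forall a : arrow quiver, bimodType (alg (source a)) (alg (target a))
}.

Definition k_central (k : fieldType) (A B : algType k) (M : bimodType A B) :=
  forall (c : k) (m : M), actl (c%:A : A) m = actr m (c%:A : B).

(* [is_rank] includes finite generation; the bimodule axioms include unitality. *)
Definition pseudo_modulation (k : fieldType) (P : modulation_data k) : Prop :=
  [/\ pseudo_valued (quiver P),
      forall i, artinian_ring (@alg k P i)
    & forall a : arrow (quiver P),
        [/\ k_central (bim a),
            is_rank (left_module (bim a)) (valuation a).1
          & is_rank (right_module (bim a)) (valuation a).2]].

Definition semi_normal (k : fieldType) (P : modulation_data k) : Prop :=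
  forall i, semisimple_ring (@alg k P i).

Definition generalized_modulation (k : fieldType) (P : modulation_data k) :
    Prop :=
  forall a : arrow (quiver P),
    bimod_iso (left_dual (bim a)) (right_dual (bim a)).

(** * Group species *)

HB.mixin Record isCentralBimodule (k : fieldType) (A B : algType k) M
    of GRing.Lmodule k M & Bimodule A B M := {
  actl_scalar : forall (c : k) (m : M), actl (c%:A : A) m = c *: m;
  actr_scalar : forall (c : k) (m : M), actr m (c%:A : B) = c *: m
}.

#[short(type="fdBimodType")]
HB.structure Definition FDBimodule (k : fieldType) (A B : algType k) :=
  {M of Vector k M & Bimodule A B M & isCentralBimodule k A B M}.

Record group_species (k : fieldType) := GroupSpecies {
  species_index : finType;
  species_group : species_index -> finGroupType;
  species_bim : forall i j : species_index,
    fdBimodType (group_algebra k (species_group i))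
                (group_algebra k (species_group j))
}.

Section SpeciesModulation.
Variables (k : fieldType) (G : group_species k).
Local Notation I := (species_index G).
Local Notation M i j := (species_bim (g := G) i j).

Definition species_arrows : {set I * I} :=
  [set ij | (fullv : {vspace M ij.1 ij.2}) != 0%VS].

Definition species_quiver : valued_quiver := {|
  vertex := I;
  arrows := species_arrows;
  valuation := fun a => (rank (left_module (M (val a).1 (val a).2)),
                         rank (right_module (M (val a).1 (val a).2)))
|}.

Definition species_modulation : modulation_data k := {|
  quiver := species_quiver;
  alg := fun i => group_algebra k (species_group i);
  bim := fun a => M (source a) (target a)
|}.

End SpeciesModulation.

(* Main.v *)
(* A k-subspace of the group algebra stable under multiplication is a submodule
   and conversely, so chain conditions follow from finite dimension and
   semisimplicity from Maschke's averaging, which needs |G| invertible in k.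
   The form (a, b) |-> (ab)(1) on a group algebra is nondegenerate, symmetric
   and associative, so a |-> a(1) identifies both Hom_A(M, A) and Hom_B(M, B)
   with the k-dual of M, compatibly with the actions of A and B. *)
From HB Require Import structures.
Require Import Defs.
From mathcomp Require Import all_boot all_fingroup all_algebra.
From mathcomp Require Import boolp classical_sets.
Import GRing.Theory.
Local Open Scope ring_scope.

(** * Subspaces given by predicates, and their descending chains *)

(** A subspace of maximal dimension inside [P] exhausts [P]: adjoining a point of [P] stays inside
    [P], so it cannot raise the dimension. *)
Lemma predicate_vspace (k : fieldType) (V : vectType k) (P : {pred V}) :
  GRing.submod_closed P -> exists U : {vspace V}, U =i P.
Proof.
move=> [P0 Plin].
pose Q n := `[< exists2 U : {vspace V}, {subset U <= P} & \dim U = n >].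
have exQ : exists n, Q n.
  exists 0%N; apply/asboolP; exists 0%VS; last by rewrite dimv0.
  by move=> x; rewrite memv0 => /eqP ->.
have ubQ n : Q n -> (n <= \dim {:V})%N.
  by move=> /asboolP[U _ <-]; apply: dimvS; exact: subvf.
case: (ex_maxnP exQ ubQ) => n /asboolP[U UP dU] maxn.
exists U => x; apply/idP/idP => [/UP //|Px].
have /asboolP/maxn : exists2 W : {vspace V},
    {subset W <= P} & \dim W = \dim (U + <[x]>).
  exists (U + <[x]>)%VS => // y /memv_addP[u Uu [v /vlineP[c ->] ->]].
  by rewrite addrC; apply: Plin => //; exact: UP.
rewrite -dU => dle.
have : U == (U + <[x]>)%VS by rewrite eqEdim addvSl dle.
by move=> /eqP ->; exact: (subvP (addvSr _ _)) (memv_line x).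
Qed.

(** The chain is constant from the first-found index of minimal dimension on. *)
Lemma submod_dcc (k : fieldType) (V : vectType k) (S : nat -> {pred V}) :
  (forall n, GRing.submod_closed (S n)) ->
  (forall n, {subset S n.+1 <= S n}) ->
  exists N, forall n, (N <= n)%N -> S n =i S N.
Proof.
move=> Slin Sdec.
have [U SU] := boolp.choice (fun n => predicate_vspace k V (S n) (Slin n)).
have Udec m n : (m <= n)%N -> (U n <= U m)%VS.
  elim: n => [|n IHn]; first by rewrite leqn0 => /eqP ->.
  rewrite leq_eqVlt => /predU1P[-> //|/IHn]; apply: subv_trans.
  by apply/subvP => x; rewrite !SU; exact: Sdec.
have exd : exists d, `[< exists n, \dim (U n) = d >].
  by exists (\dim (U 0%N)); apply/asboolP; exists 0%N.
case: (ex_minnP exd) => _ /asboolP[N <-] minN.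
exists N => n leNn x; rewrite -!SU.
suff /eqP -> : U n == U N by [].
by rewrite eqEdim Udec // minN //; apply/asboolP; exists n.
Qed.

(** * Standard basis and trace form of a group algebra *)

Section GroupAlgebra.
Variables (k : fieldType) (gT : finGroupType).
Local Notation kG := (group_algebra k gT).

Definition galg_basis (x : gT) : kG := [ffun y => (y == x)%:R].

Lemma galg_mulE (a b : kG) x : (a * b) x = \sum_y a y * b (y^-1 * x)%g.
Proof. exact: ffunE. Qed.

Lemma galg_subE (a b : kG) x : (a - b) x = a x - b x.
Proof. by rewrite !ffunE. Qed.

Lemma galg_basisMl x (a : kG) y : (galg_basis x * a) y = a (x^-1 * y)%g.
Proof.
rewrite galg_mulE (bigD1 x) //= ffunE eqxx mul1r big1 ?addr0 // => z /negPf zx.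
by rewrite ffunE zx mul0r.
Qed.

Lemma galg_basisMr x (a : kG) y : (a * galg_basis x) y = a (y * x^-1)%g.
Proof.
rewrite galg_mulE (bigD1 (y * x^-1)%g) //= ffunE invMg invgK mulgKV eqxx mulr1.
rewrite big1 ?addr0 // => z zx; rewrite ffunE (_ : (_ == _) = false) ?mulr0 //.
by apply: contraNF zx => /eqP <-; rewrite invMg invgK mulKVg.
Qed.

Lemma galg_basisM x y : galg_basis x * galg_basis y = galg_basis (x * y)%g.
Proof.
apply/ffunP => z; rewrite galg_basisMl !ffunE.
by rewrite -(inj_eq (mulgI x)) mulKVg.
Qed.

Lemma galg_basis1 : galg_basis 1 = 1.
Proof. by []. Qed.

Lemma galg_sum_basis (a : kG) : a = \sum_x a x *: galg_basis x.
Proof.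
apply/ffunP => y; rewrite sum_ffunE (bigD1 y) //= big1 ?addr0.
  by rewrite !ffunE eqxx; exact: esym (mulr1 _).
by move=> x /negPf xy; rewrite !ffunE eq_sym xy; exact: mulr0.
Qed.

(** Both sides are the sum of a(x^-1) b(x) over the group, as k is commutative. *)
Lemma galg_trace (a b : kG) : (a * b) 1%g = (b * a) 1%g.
Proof.
rewrite !galg_mulE (reindex_inj invg_inj); apply: eq_bigr => x _ /=.
by rewrite !mulg1 invgK mulrC.
Qed.

(** Nondegeneracy of the form: pairing with the group element x^-1 reads off the coefficient at
    x. *)
Lemma galg_trace_inj (a b : kG) :
  (forall c, (a * c) 1%g = (b * c) 1%g) -> a = b.
Proof.
move=> eqab; apply/ffunP => x; have := eqab (galg_basis x^-1).
by rewrite !galg_basisMr invgK mul1g.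
Qed.

(** The element that represents [phi] through the trace form. *)
Definition galg_riesz (phi : {linear kG -> k^o}) : kG :=
  [ffun x => phi (galg_basis x^-1)].

Lemma galg_rieszP phi a : (galg_riesz phi * a) 1%g = phi a.
Proof.
rewrite [in RHS](galg_sum_basis a) linear_sum galg_mulE (reindex_inj invg_inj).
by apply: eq_bigr => x _; rewrite /= ffunE linearZ mulg1 invgK mulrC.
Qed.

(** Submodules of either regular module are k-subspaces, since c acts as multiplication by
    [c%:A]. *)
Lemma galg_artinian : artinian_ring kG.
Proof.
split=> S Ssub Sdec; apply: (@submod_dcc k kG) => // n;
  have [S0 Slin] := Ssub n; split=> // c u v Su Sv.
  by rewrite -mulr_algl; exact: (Slin (c%:A : kG)).
by rewrite -mulr_algr; exact: (Slin (c%:A : kG)).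
Qed.

Definition left_ideal (U : {vspace kG}) := forall a x : kG, x \in U -> a * x \in U.

(** * Maschke's theorem: complements of left ideals *)

Section Maschke.
Hypothesis G_neq0 : #|gT|%:R != 0 :> k.
Variable U : {vspace kG}.

(** The average of the conjugates g p g^-1 of a k-linear projection p onto [U]. *)
Definition maschke_fun (v : kG) : kG :=
  #|gT|%:R^-1 *: \sum_g galg_basis g * projv U (galg_basis g^-1 * v).

Fact maschke_fun_linear : linear maschke_fun.
Proof.
move=> c u v; rewrite /maschke_fun scalerA mulrC -scalerA -scalerDr; congr (_ *: _).
rewrite scaler_sumr -big_split; apply: eq_bigr => g _ /=.
by rewrite mulrDr linearD -scalerAr linearZ mulrDr -scalerAr.
Qed.

HB.instance Definition _ :=
  GRing.isLinear.Build k kG kG *:%R maschke_fun maschke_fun_linear.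

Lemma maschke_funM (a v : kG) : maschke_fun (a * v) = a * maschke_fun v.
Proof.
rewrite [a]galg_sum_basis !mulr_suml linear_sum; apply: eq_bigr => h _.
rewrite -!scalerAl linearZ /=; congr (_ *: _).
rewrite /maschke_fun -scalerAr; congr (_ *: _).
(* After g is replaced by hg, the inner h^-1 cancels h and the outer h factors out. *)
rewrite (reindex_inj (mulgI h)) mulr_sumr; apply: eq_bigr => g _ /=.
rewrite [RHS]mulrA galg_basisM; congr (_ * projv U _).
by rewrite mulrA galg_basisM invMg mulgKV.
Qed.

Hypothesis Uid : left_ideal U.

Lemma maschke_fun_mem v : maschke_fun v \in U.
Proof. by apply/memvZ/memv_suml => g _; apply: Uid; exact: memv_proj. Qed.

(** Each g^-1 v lies in [U] and is fixed by the projection, so every summand is v. *)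
Lemma maschke_fun_id v : v \in U -> maschke_fun v = v.
Proof.
move=> Uv; rewrite /maschke_fun (eq_bigr (fun=> v)) => [|g _].
  by rewrite sumr_const -scaler_nat scalerA mulVf // scale1r.
by rewrite projv_id ?Uid // mulrA galg_basisM mulgV galg_basis1 mul1r.
Qed.

(** The complement is the kernel of the averaged projection, a left ideal because that projection is
    kG-linear. *)
Lemma maschke : exists W : {vspace kG},
  [/\ left_ideal W, (U :&: W = 0)%VS & (U + W = fullv)%VS].
Proof.
exists (lker (linfun maschke_fun)); split.
- move=> a x; rewrite !memv_ker !lfunE /= => /eqP xK.
  by rewrite maschke_funM xK mulr0.
- apply/eqP; rewrite -subv0; apply/subvP => x /memv_capP[Ux].
  by rewrite memv_ker lfunE /= maschke_fun_id // memv0.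
- apply/eqP; rewrite eqEsubv subvf; apply/subvP => x _.
  rewrite -(subrKC (maschke_fun x) x); apply: memv_add (maschke_fun_mem x) _.
  by rewrite memv_ker lfunE /= linearB /= [maschke_fun (_ x)]maschke_fun_id
    ?maschke_fun_mem // subrr.
Qed.

End Maschke.

(** * Decomposition into simple left ideals *)

Definition simple_ideal (U : {vspace kG}) :=
  [/\ left_ideal U, U != 0%VS & forall T : {vspace kG},
      left_ideal T -> (T <= U)%VS -> T = 0%VS \/ T = U].

(** Induction on dimension: if [U] is not simple, it contains a nonzero left ideal of smaller
    dimension. *)
Lemma exists_simple_ideal (U : {vspace kG}) : left_ideal U -> U != 0%VS ->
  exists2 L : {vspace kG}, (L <= U)%VS & simple_ideal L.
Proof.
have [n] := ubnP (\dim U); elim: n => // n IHn in U *; rewrite ltnS => dU Uid U0.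
have [[T [Tid TU T0 TneqU]]|noT] := pselect (exists T : {vspace kG},
    [/\ left_ideal T, (T <= U)%VS, T != 0%VS & T != U]).
  have dT : (\dim T < n)%N.
    apply: leq_trans dU; rewrite ltnNge; apply: contra TneqU => dUT.
    by rewrite eqEdim TU.
  by have [L LT Ls] := IHn _ dT Tid T0; exists L => //; exact: subv_trans TU.
exists U => //; split=> // T Tid TU.
have [->|T0] := eqVneq T 0%VS; first by left.
by right; apply: contrapT => /eqP TneqU; apply: noT; exists T.
Qed.

Lemma ideal_decomposition (U : {vspace kG}) : #|gT|%:R != 0 :> k -> left_ideal U ->
  exists n (L : 'I_n -> {vspace kG}), [/\ forall i, simple_ideal (L i),
    (\sum_i L i)%VS = U & directv (\sum_i L i)].
Proof.
(* Directness is carried through the induction as additivity of dimensions. *)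
move=> G0; suff dec : left_ideal U -> exists n (L : 'I_n -> {vspace kG}),
    [/\ forall i, simple_ideal (L i), (\sum_i L i)%VS = U
      & (\sum_i \dim (L i))%N = \dim U].
  move=> /dec[n [L [Ls LU dL]]]; exists n, L; split=> //.
  by rewrite directvE /= dL LU.
have [n] := ubnP (\dim U); elim: n => // n IHn in U *; rewrite ltnS => dU Uid.
have [->|U0] := eqVneq U 0%VS.
  exists 0%N, (fun=> 0%VS); split; first by case.
    by rewrite big_ord0.
  by rewrite big_ord0 dimv0.
have [L LU Ls] := exists_simple_ideal _ Uid U0; have [Lid L0 _] := Ls.
have [C [Cid LC0 LCf]] := maschke G0 L Lid.
(* By the modular law, intersecting the global complement [C] with [U] gives a complement of [L]
   inside [U]. *)
have LW0 : (L :&: (U :&: C) = 0)%VS by rewrite capvA (capv_idPl LU).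
have LWU : (L + (U :&: C) = U)%VS.
  apply/eqP; rewrite eqEsubv subv_add LU capvSl; apply/subvP => x Ux.
  have : x \in (L + C)%VS by rewrite LCf memvf.
  case/memv_addP=> l Ll [c Cc defx]; rewrite defx memv_add // memv_cap Cc andbT.
  by rewrite -(addKr l c) -defx addrC rpredB // (subvP LU).
have dLW := dimv_disjoint_sum LW0; rewrite LWU in dLW.
have dW : (\dim (U :&: C) < n)%N.
  by apply: leq_trans dU; rewrite dLW -[ltnLHS]add0n ltn_add2r lt0n dimv_eq0.
have Wid : left_ideal (U :&: C).
  by move=> a x /memv_capP[Ux Cx]; rewrite memv_cap Uid // Cid.
have [m [K [Ks KW dK]]] := IHn _ dW Wid.
(* Index 0 carries [L]; the remaining indices carry the family [K] shifted by one. *)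
exists m.+1, (fun i => oapp K L (unlift ord0 i)); split.
- by move=> i; case: (unlift _ _).
- rewrite big_ord_recl unlift_none /= -[RHS]LWU -KW; congr (_ + _)%VS.
  by apply: eq_bigr => i _; rewrite liftK.
- rewrite big_ord_recl unlift_none /= dLW -dK; congr (_ + _)%N.
  by apply: eq_bigr => i _; rewrite liftK.
Qed.

(** Passes from subspaces to the predicates of [simple_submodule]: any submodule [T] is itself a
    subspace, so simplicity of [U] applies to it. *)
Lemma simple_ideal_submodule (U : {vspace kG}) :
  simple_ideal U -> simple_submodule (M := kG^o) [pred x | x \in U].
Proof.
move=> [Uid U0 Us]; split.
- split=> [|a x y]; rewrite !inE ?mem0v // => Ux Uy.
  by rewrite memvD // Uid.
- by exists (vpick U); rewrite ?inE ?memv_pick ?vpick0.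
- move=> T [T0 Tlin] TU.
  have [|W WT] := @predicate_vspace k kG T.
    by split=> // c u v Tu Tv; rewrite -mulr_algl; exact: Tlin.
  have Wid : left_ideal W.
    move=> a x; rewrite !WT => Tx.
    by have := Tlin a x 0 Tx T0; rewrite addr0.
  have WU : (W <= U)%VS by apply/subvP => x; rewrite WT => /TU.
  have [eqW|eqW] := Us W Wid WU; [left|right] => x; rewrite -WT eqW //.
  by rewrite memv0.
Qed.

Lemma galg_semisimple : #|gT|%:R != 0 :> k -> semisimple_ring kG.
Proof.
move=> G0.
have [|n [L [Ls Lf Ld]]] := ideal_decomposition fullv G0; first by move=> *; exact: memvf.
exists n, (fun i => [pred x | x \in L i] : {pred kG^o}); split=> [i|x].
  exact: simple_ideal_submodule.
have /memv_sumP[c cL defx] : x \in (\sum_i L i)%VS by rewrite Lf memvf.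
exists (finfun c); split=> [|c' [c'L defx']].
  by split=> [i|]; rewrite ?ffunE ?inE ?cL // defx; apply: eq_bigr => i _; rewrite ffunE.
apply/ffunP => i; rewrite ffunE.
have /directv_sum_unique/(_ c c' cL (fun i _ => c'L i)) := Ld.
by rewrite -defx -defx' eqxx => /esym/forallP/(_ i)/eqP.
Qed.

End GroupAlgebra.

(** * Ranks of finitely generated modules *)

(** One finite generating family ensures that a least size exists, so [xget] does not fall back on
    its default. *)
Lemma is_rank_rank (R : pzRingType) (M : lmodType R) n :
  generated_by M n -> is_rank M (rank M).
Proof.
move=> Mn; rewrite /rank; have exM : exists n, `[< generated_by M n >].
  by exists n; apply/asboolP.
apply: (@xgetPex _ 0%N [set n | is_rank M n]%classic).
case: (ex_minnP exM) => m /asboolP Mm minm.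
by exists m; split=> // p Mp; apply/minm/asboolP.
Qed.

Section CentralBimodule.
Variables (k : fieldType) (A B : algType k) (M : fdBimodType A B).

(** A k-basis generates, since k acts through the scalars [c%:A] of the algebra. *)
Lemma left_generated : generated_by (left_module M) (\dim {:M}).
Proof.
exists (fun i => (vbasis {:M})`_i) => x.
exists (fun i => (coord (vbasis {:M}) i x)%:A).
rewrite [LHS](coord_vbasis (memvf (x : M))).
by apply: eq_bigr => i _; rewrite -(actl_scalar (s := M)).
Qed.

Lemma right_generated : generated_by (right_module M) (\dim {:M}).
Proof.
exists (fun i => (vbasis {:M})`_i) => x.
exists (fun i => (coord (vbasis {:M}) i x)%:A).
rewrite [LHS](coord_vbasis (memvf (x : M))).
by apply: eq_bigr => i _; rewrite -(actr_scalar (s := M)).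
Qed.

End CentralBimodule.

Lemma rank_gt0 (R : pzRingType) (M : lmodType R) n (x : M) :
  generated_by M n -> x != 0 -> (0 < rank M)%N.
Proof.
move=> /is_rank_rank [[v gen] _]; apply: contraNT; rewrite -eqn0Ngt => /eqP r0.
have [c ->] := gen x; rewrite big1 // => i _.
(* With rank 0 there is no index i: x would be an empty sum. *)
by have := ltn_ord i; rewrite {2}r0.
Qed.

(** * Evaluation of elements of the two duals *)

Section DualEvaluation.
Variables (R S : nzRingType) (M : bimodType R S).

Lemma ldual_evalD (f : left_dual M) m m' :
  ldual_eval f (m + m') = ldual_eval f m + ldual_eval f m'.
Proof. exact: (raddfD (f : {linear left_module M -> R^o})). Qed.

Lemma ldual_evalM (f : left_dual M) r m :
  ldual_eval f (actl r m) = r * ldual_eval f m.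
Proof. exact: (linearZ_LR (f : {linear left_module M -> R^o})). Qed.

Lemma rdual_evalD (g : right_dual M) m m' :
  rdual_eval g (m + m') = rdual_eval g m + rdual_eval g m'.
Proof. exact: (raddfD (g : {linear right_module M -> (S^c)^o})). Qed.

Lemma rdual_evalM (g : right_dual M) m s :
  rdual_eval g (actr m s) = rdual_eval g m * s.
Proof. exact: (linearZ_LR (g : {linear right_module M -> (S^c)^o})). Qed.

End DualEvaluation.

(** * Isomorphism of the two duals through the trace forms *)

Section DualIso.
Variables (k : fieldType) (gT hT : finGroupType).
Local Notation A := (group_algebra k gT).
Local Notation B := (group_algebra k hT).
Variable M : fdBimodType A B.

Section LeftToRight.
Variable f : left_dual M.

(** Representing this functional of s by an element g(m) of B defines the right dual map g, with
    (g(m)s)(1) = f(ms)(1). *)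
Definition left_functional (m : M) (s : B) : k^o := ldual_eval f (actr m s) 1%g.

Fact left_functional_linear m : linear (left_functional m).
Proof.
move=> c s s'; rewrite /left_functional actrDr -mulr_algr -actrA.
(* Centrality moves the scalar from the right of [M] to the left, where f is linear. *)
rewrite (actr_scalar (s := M)) -(actl_scalar (s := M)) ldual_evalD ldual_evalM.
by rewrite mulr_algl !ffunE.
Qed.

HB.instance Definition _ m :=
  GRing.isLinear.Build k B k^o *:%R (left_functional m) (left_functional_linear m).

Definition left_to_right_fun (m : right_module M) : (B^c)^o :=
  galg_riesz k hT (left_functional m).

Lemma left_to_right_funP (m : M) (s : B) :
  ((left_to_right_fun m : B) * s) 1%g = ldual_eval f (actr m s) 1%g.
Proof. exact: galg_rieszP. Qed.

Fact left_to_right_linear : linear left_to_right_fun.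
Proof.
move=> s m m'.
(* Linearity over the converse ring, rewritten as right B-linearity. *)
suff: (left_to_right_fun (actr (m : M) s + (m' : M)) : B)
    = (left_to_right_fun m : B) * s + (left_to_right_fun m' : B) by [].
apply: galg_trace_inj => s'.
rewrite left_to_right_funP mulrDl -mulrA ffunE !left_to_right_funP.
by rewrite actrDl actrA ldual_evalD ffunE.
Qed.

HB.instance Definition _ := GRing.isLinear.Build B^c (right_module M) (B^c)^o *:%R
  left_to_right_fun left_to_right_linear.

Definition left_to_right : right_dual M :=
  (left_to_right_fun : {linear right_module M -> (B^c)^o}).

Lemma left_to_rightP (m : M) (s : B) :
  (rdual_eval left_to_right m * s) 1%g = ldual_eval f (actr m s) 1%g.
Proof. exact: galg_rieszP. Qed.

End LeftToRight.

Section RightToLeft.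
Variable g : right_dual M.

Definition right_functional (m : M) (r : A) : k^o := rdual_eval g (actl r m) 1%g.

Fact right_functional_linear m : linear (right_functional m).
Proof.
move=> c r r'; rewrite /right_functional actlDl -mulr_algl -actlA.
rewrite (actl_scalar (s := M)) -(actr_scalar (s := M)) rdual_evalD rdual_evalM.
by rewrite mulr_algr !ffunE.
Qed.

HB.instance Definition _ m :=
  GRing.isLinear.Build k A k^o *:%R (right_functional m) (right_functional_linear m).

Definition right_to_left_fun (m : left_module M) : A^o :=
  galg_riesz k gT (right_functional m).

Lemma right_to_left_funP (m : M) (r : A) :
  ((right_to_left_fun m : A) * r) 1%g = rdual_eval g (actl r m) 1%g.
Proof. exact: galg_rieszP. Qed.

Fact right_to_left_linear : linear right_to_left_fun.
Proof.
move=> r m m'.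
suff: (right_to_left_fun (actl r (m : M) + (m' : M)) : A)
    = r * (right_to_left_fun m : A) + (right_to_left_fun m' : A) by [].
apply: galg_trace_inj => r'.
(* Here r multiplies the value a on the left; symmetry of the form gives (r a r')(1) = (a r'
   r)(1). *)
rewrite right_to_left_funP mulrDl -mulrA [in RHS]ffunE [in RHS]galg_trace -mulrA.
by rewrite !right_to_left_funP actlDr actlA rdual_evalD ffunE.
Qed.

HB.instance Definition _ := GRing.isLinear.Build A (left_module M) A^o *:%R
  right_to_left_fun right_to_left_linear.

Definition right_to_left : left_dual M :=
  (right_to_left_fun : {linear left_module M -> A^o}).

Lemma right_to_leftP (m : M) (r : A) :
  (ldual_eval right_to_left m * r) 1%g = rdual_eval g (actl r m) 1%g.
Proof. exact: galg_rieszP. Qed.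

End RightToLeft.

Lemma ldual_ext (f f' : left_dual M) :
  (forall m r, (ldual_eval f m * r) 1%g = (ldual_eval f' m * r) 1%g) -> f = f'.
Proof.
by move=> eqf; apply: lin_hom_ext => m; apply: galg_trace_inj; exact: eqf.
Qed.

Lemma rdual_ext (g g' : right_dual M) :
  (forall m s, (rdual_eval g m * s) 1%g = (rdual_eval g' m * s) 1%g) -> g = g'.
Proof.
move=> eqg; apply: lin_hom_ext => m; apply: (galg_trace_inj k hT).
exact: eqg.
Qed.

(** With g the image of f, pairing with 1 gives g(rm)(1) = f(rm)(1) = (r f(m))(1), which is (f(m)
    r)(1) by symmetry. *)
Lemma left_to_rightK : cancel left_to_right right_to_left.
Proof.
move=> f; apply: ldual_ext => m r; rewrite right_to_leftP -[rdual_eval _ _]mulr1.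
by rewrite left_to_rightP actr1 ldual_evalM galg_trace.
Qed.

Lemma right_to_leftK : cancel right_to_left left_to_right.
Proof.
move=> g; apply: rdual_ext => m s; rewrite left_to_rightP -[ldual_eval _ _]mulr1.
by rewrite right_to_leftP actl1 rdual_evalM.
Qed.

Fact left_to_right_zmod_morphism : zmod_morphism left_to_right.
Proof.
move=> f f'; apply: rdual_ext => m s.
rewrite (_ : rdual_eval (left_to_right f - left_to_right f') m
  = rdual_eval (left_to_right f) m - rdual_eval (left_to_right f') m) //.
by rewrite mulrBl galg_subE !left_to_rightP -galg_subE.
Qed.

HB.instance Definition _ := GRing.isZmodMorphism.Build
  (left_dual M) (right_dual M) left_to_right left_to_right_zmod_morphism.

Lemma galg_bimod_duals_iso : bimod_iso (left_dual M) (right_dual M).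
Proof.
exists left_to_right; split.
- exact: Bijective left_to_rightK right_to_leftK.
- move=> s f; apply: rdual_ext => m s'; rewrite left_to_rightP.
  (* The actions unfold to (sf)(m) = f(ms) and (sg)(m) = s g(m); symmetry of the form matches
     them. *)
  change (ldual_eval f (actr (actr m s') s) 1%g
    = (s * rdual_eval (left_to_right f) m * s') 1%g).
  by rewrite -mulrA galg_trace -mulrA left_to_rightP actrA.
- move=> f r; apply: rdual_ext => m s; rewrite left_to_rightP.
  change ((ldual_eval f (actr m s) * r) 1%g
    = (rdual_eval (left_to_right f) (actl r m) * s) 1%g).
  by rewrite left_to_rightP lactrA ldual_evalM galg_trace.
Qed.

End DualIso.

(** * The pseudo-modulation of a group species *)

Theorem proposition6p1 (k : closedFieldType) (k_char0 : [pchar k] =i pred0)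
    (G : group_species k) :
  [/\ pseudo_modulation (species_modulation G),
      semi_normal (species_modulation G)
    & generalized_modulation (species_modulation G)].
Proof.
split; last by move=> a; exact: galg_bimod_duals_iso.
- split.
  (* An arrow means a nonzero bimodule, so [vpick] supplies a nonzero vector and both ranks are
     positive. *)
  + move=> [[i j] /= aij]; have := aij; rewrite inE -vpick0 => v0.
    by split; [apply: rank_gt0 (left_generated _ _ _ _) v0
      | apply: rank_gt0 (right_generated _ _ _ _) v0].
  + by move=> i; exact: galg_artinian.
  + move=> a; split.
    * by move=> c m; rewrite [LHS]actl_scalar [RHS]actr_scalar.
    * exact: is_rank_rank (left_generated _ _ _ _).
    * exact: is_rank_rank (right_generated _ _ _ _).
- move=> i; apply: galg_semisimple.
  (* In characteristic 0 the positive integer |G| stays nonzero in k. *)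
  by rewrite ((pcharf0P k).1 k_char0) -lt0n; apply/card_gt0P; exists 1%g.
Qed.
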